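(* Let $d>1$ be an integer and let $S\subseteq \mathbb{N}^d$ be a generalized numerical semigroup with embedding dimension $\operatorname{e}(S)=2d+1$. Then $S$ is symmetric if and only if $|\operatorname{FA}(S)|=1$. Moreover, for generalized numerical semigroups in $\mathbb{N}^d$ of embedding dimension $2d+1$ (with $d>1$), the symmetric ones and the almost symmetric ones coincide; that is, such an $S$ is almost symmetric if and only if it is symmetric.
   Context: $\mathbb{N}$ is the set of nonnegative integers. A generalized numerical semigroup is an additive submonoid $S\subseteq\mathbb{N}^d$ whose set of gaps $\mathcal{H}(S)=\mathbb{N}^d\setminus S$ is finite. Every generalized numerical semigroup has a unique minimal set of generators (as a monoid), which is finite; its cardinality is the embedding dimension $\operatorname{e}(S)$. The natural partial order on $\mathbb{N}^d$ is: $\mathbf{x}\leq_{\mathbb{N}^d}\mathbf{y}$ if and only if $\mathbf{y}-\mathbf{x}\in\mathbb{N}^d$. The set of Frobenius-allowable elements $\operatorname{FA}(S)$ is the set of maximal elements of $\mathcal{H}(S)$ with respect to $\leq_{\mathbb{N}^d}$. The set of pseudo-Frobenius elements is $\operatorname{PF}(S)=\{\mathbf{h}\in\mathcal{H}(S)\mid \mathbf{h}+\mathbf{s}\in S \text{ for all } \mathbf{s}\in S\setminus\{\mathbf{0}\}\}$, and the type is $\operatorname{t}(S)=|\operatorname{PF}(S)|$. $S$ is symmetric if $\operatorname{t}(S)=1$. $S$ is almost symmetric if $\operatorname{FA}(S)=\{\mathbf{f}\}$ for a single element $\mathbf{f}$ and $\mathbf{f}-\mathbf{p}\in\operatorname{PF}(S)$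 for all $\mathbf{p}\in\operatorname{PF}(S)\setminus\{\mathbf{f}\}$. *)

(* Defs.v *)
From mathcomp Require Import all_boot all_algebra finmap.
From mathcomp Require Import all_classical.

Set Implicit Arguments.
Unset Strict Implicit.
Unset Printing Implicit Defensive.

Import GRing.Theory.
Local Open Scope classical_set_scope.
Local Open Scope ring_scope.

Section GeneralizedNumericalSemigroups.
Variable d : nat.
Local Notation Nd := 'rV[nat]_d.
Implicit Types (S A : set Nd) (x y f : Nd).

(* y - x lies in N^d; subtraction on nat is truncated, hence the witness. *)
Definition natural_le x y : Prop := exists z : Nd, x + z = y.

Definition submonoid S : Prop := Algebra.nmod_closed [in S].

Definition gaps S : set Nd := ~` S.

Definition gen_num_semigroup S : Prop := submonoid S /\ finite_set (gaps S).

Definition generates A S : Prop := smallest submonoid A = S.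

Definition minimal_generators S A : Prop :=
  generates A S /\ forall B : set Nd, B `<=` A -> generates B S -> B = A.

(* A generalized numerical semigroup has exactly one minimal generating set,
   so that xget involves no real choice there. *)
Definition min_gens S : set Nd := xget set0 [set A | minimal_generators S A].

(* Junk value 0 on infinite sets. *)
Definition set_card A : nat := #|` fset_set A |.

Definition embedding_dim S : nat := set_card (min_gens S).

Definition frobenius_allowable S : set Nd :=
  [set h | gaps S h /\ forall h', gaps S h' -> natural_le h h' -> h' = h].

Definition pseudo_frobenius S : set Nd :=
  [set h | gaps S h /\ forall s, S s -> s <> 0 -> S (h + s)].

Definition semigroup_type S : nat := set_card (pseudo_frobenius S).

Definition symmetric_semigroup S : Prop := semigroup_type S = 1%N.

(* The witness q is f - p, computed without truncation. *)
Definition almost_symmetric S : Prop :=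
  exists2 f, frobenius_allowable S = [set f] &
    forall p, pseudo_frobenius S p -> p <> f ->
      exists2 q, pseudo_frobenius S q & p + q = f.

End GeneralizedNumericalSemigroups.

(* Main.v *)
Require Import Defs.
From mathcomp Require Import all_boot all_algebra finmap.
From mathcomp Require Import all_classical.
From mathcomp Require Import zify.

Set Implicit Arguments.
Unset Strict Implicit.
Unset Printing Implicit Defensive.

(** Every maximal gap is a pseudo-Frobenius element, and maximal gaps exist as
    soon as there are gaps. So everything reduces to one implication: if f is the
    only maximal gap, then every pseudo-Frobenius element p equals f. Indeed
    symmetry, |FA(S)| = 1 and almost symmetry then all say that FA(S) is a
    singleton, which makes PF(S) the same singleton.

    The minimal generators of S are its atoms ([min_gensE]). Let e_i be the
    standard basis vectors. Each axis carries an atom, and two of them if S misses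
    e_i ([ex_two_axis_atoms]); moreover, if S misses e_i, then for every j <> i
    there is an atom e_i + n_j e_j ([ex_mixed_atom]). With 2 d + 1 atoms in all,
    this leaves three possibilities.

    - S misses two basis vectors e_i and e_j. Counting gives d = 2 and
      makes e_i + e_j the only atom off the axes ([atoms_two_missing_units]). Then
      a gap g e_j yields the gap e_i + (g + 1) e_j, and symmetrically, so neither
      f_i e_i nor f_j e_j can be a gap; but their sum is f
      ([two_missing_units_absurd]).

    - S misses only e_i, and the i-th axis carries exactly two atoms. Being a gap
      of S then depends, in each slice of constant i-th coordinate, monotonically
      on the other coordinates, and f_i is the Frobenius number of the axis
      semigroup T. As T has two generators it is symmetric, so f_i - p_i is in T,
      and adding (f_i - p_i) e_i to p leads to a vector below f in the slice of f;
      this vector is a gap, so nothing was added and p = f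
      ([PF_eq_f_two_axis_atoms]).

    - S misses only e_i, and the i-th axis carries at least three atoms. Counting
      shows that all other atoms are the e_j and the e_i + n_j e_j
      ([atoms_one_missing_unit]). Membership in S is then explicit in terms of T
      and of the n_j, uniqueness of f forces T to consist of multiples of its
      multiplicity up to f_i, and a pseudo-Frobenius element p <> f would be an
      element of S ([PF_eq_f_levels]). *)

(** * Coordinates and axis vectors in N^d *)

Section Vectors.
Variable d : nat.
Local Notation Nd := 'rV[nat]_d.
Implicit Types (x y z : Nd) (i j : 'I_d).

Lemma coordP x y : x = y <-> forall j, x ord0 j = y ord0 j.
Proof. by split=> [->//|xy]; apply/rowP. Qed.

Lemma coordD x y j : (x + y)%R ord0 j = x ord0 j + y ord0 j.
Proof. by rewrite mxE. Qed.

Lemma coord0 j : (0%R : Nd) ord0 j = 0.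
Proof. by rewrite mxE. Qed.

Definition axis i (n : nat) : Nd := (\row_j (if j == i then n else 0)%N)%R.

Lemma axisE i n j : axis i n ord0 j = if j == i then n else 0.
Proof. by rewrite mxE. Qed.

Lemma axisii i n : axis i n ord0 i = n.
Proof. by rewrite axisE eqxx. Qed.

Lemma axis_neq i j n : j != i -> axis i n ord0 j = 0.
Proof. by rewrite axisE => /negbTE ->. Qed.

Lemma axisD i m n : axis i (m + n) = (axis i m + axis i n)%R.
Proof. by apply/coordP => j; rewrite coordD !axisE; case: eqP. Qed.

Lemma axis0 i : axis i 0 = 0%R.
Proof. by apply/coordP => j; rewrite coord0 axisE; case: eqP. Qed.

Lemma axis_inj i m n : axis i m = axis i n -> m = n.
Proof. by move/coordP/(_ i); rewrite !axisii. Qed.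

Lemma sum_axis x : (\sum_j axis j (x ord0 j))%R = x.
Proof.
apply/coordP => j; rewrite summxE (bigD1 j) //= big1 ?axisii ?GRing.addr0 //.
by move=> k kj; rewrite axis_neq // eq_sym.
Qed.

(** The coordinates of z are kept next to y = x + z because there is no
    subtraction of vectors over nat to name z. *)
Lemma leq_complement x y : (forall j, x ord0 j <= y ord0 j) ->
  exists2 z, y = (x + z)%R & forall j, z ord0 j = y ord0 j - x ord0 j.
Proof.
move=> le_xy; exists (\row_j (y ord0 j - x ord0 j)%N)%R; last by move=> j; rewrite mxE.
by apply/coordP => j; rewrite coordD mxE subnKC.
Qed.

Lemma natural_leP x y : natural_le x y <-> forall j, x ord0 j <= y ord0 j.
Proof.
split=> [[z <-] j|/leq_complement[z ->]]; first by rewrite coordD leq_addr.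
by exists z.
Qed.

(** The measure for all inductions along decompositions in S and along chains
    of gaps. *)
Definition weight x : nat := \sum_j x ord0 j.

Lemma weightD x y : weight (x + y)%R = weight x + weight y.
Proof. by rewrite -big_split; apply: eq_bigr => j _; rewrite coordD. Qed.

Lemma weight_eq0 x : weight x = 0 -> x = 0%R.
Proof.
move/eqP; rewrite sum_nat_eq0 => /forallP x0.
by apply/coordP => j; rewrite coord0; have /eqP := x0 j.
Qed.

Lemma weight_gt0 x : x <> 0%R -> 0 < weight x.
Proof. by case: posnP => // /weight_eq0. Qed.

Lemma coord_le_weight x j : x ord0 j <= weight x.
Proof. by rewrite /weight (bigD1 j) //= leq_addr. Qed.

End Vectors.

(** * Atoms are the minimal generators *)

Lemma submonoidP d (S : set 'rV[nat]_d) : submonoid S <->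
  S 0%R /\ forall x y, S x -> S y -> S (x + y)%R.
Proof.
rewrite /submonoid; split=> -[S0 SD].
  by split=> [|x y Sx Sy]; apply/set_mem; [exact: S0 | apply: SD; apply/mem_set].
by split=> [|x y /set_mem Sx /set_mem Sy]; apply/mem_set => //; apply: SD.
Qed.

Section Atoms.
Variables (d : nat) (S : set 'rV[nat]_d).
Local Notation Nd := 'rV[nat]_d.
Implicit Types (x y z : Nd) (i j : 'I_d).

Definition atom x : Prop := [/\ S x, x <> 0%R &
  forall y z, S y -> S z -> x = (y + z)%R -> y = 0%R \/ z = 0%R].

Hypothesis SM : submonoid S.

Lemma mem0 : S 0%R. Proof. by case/submonoidP: SM. Qed.

Lemma memD x y : S x -> S y -> S (x + y)%R.
Proof. by case/submonoidP: SM => _; exact. Qed.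

(** Any proper decomposition x = y + z lowers the weight, so following the left
    summand ends in an atom. *)
Lemma split_atom x : S x -> x <> 0%R ->
  exists a y, [/\ atom a, S y & x = (a + y)%R].
Proof.
have [n] := ubnP (weight x); elim: n x => // n IHn x lt_xn Sx x0.
have [ax|nax] := pselect (atom x).
  by exists x, 0%R; split => //; [exact: mem0 | rewrite GRing.addr0].
have [y [z [Sy Sz xE y0 z0]]] : exists y z,
    [/\ S y, S z, x = (y + z)%R, y <> 0%R & z <> 0%R].
  apply: contrapT => nex; apply: nax; split=> // y z Sy Sz xE.
  by apply: contrapT => /not_orP[y0 z0]; apply: nex; exists y, z.
have [|a [y' [aa Sy' yE]]] := IHn y _ Sy y0.
  by move: lt_xn; rewrite xE weightD; have := weight_gt0 z0; lia.
exists a, (y' + z)%R; split=> //; first exact: memD.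
by rewrite xE yE GRing.addrA.
Qed.

(** Facts about all elements of S follow from a classification of its atoms by
    adding one atom at a time. *)
Lemma atom_ind (P : Nd -> Prop) : P 0%R ->
  (forall a x, atom a -> S x -> P x -> P (a + x)%R) ->
  forall x, S x -> P x.
Proof.
move=> P0 PD x; have [n] := ubnP (weight x); elim: n x => // n IHn x lt_xn Sx.
have [->//|x0] := pselect (x = 0%R).
have [a [y [aa Sy xE]]] := split_atom Sx x0.
rewrite xE; apply: PD => //; apply: IHn => //.
have [_ a0 _] := aa.
by move: lt_xn; rewrite xE weightD; have := weight_gt0 a0; lia.
Qed.

Lemma generates_atom : generates [set x | atom x]%classic S.
Proof.
apply/seteqP; split=> x.
  by apply; split=> // y [].
move=> Sx B [/submonoidP[B0 BD] aB]; move: x Sx.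
by apply: atom_ind => // a x aa _ Bx; apply: BD => //; apply: aB.
Qed.

(** An atom is not a sum of other elements of S, so no generating set can do
    without it. *)
Lemma atom_sub_generators (A : set Nd) : generates A S ->
  ([set x | atom x] `<=` A)%classic.
Proof.
move=> AS a aa; apply: contrapT => nAa.
have [Sa a0 airr] := aa.
(* S without the atom a is still a submonoid, and it would contain A. *)
have : smallest (@submonoid d) A a by rewrite [smallest _ _]AS.
move=> /(_ [set x | S x /\ x <> a]%classic)[]//; split.
  apply/submonoidP; split=> [|x y [Sx xa] [Sy ya]].
    by split; [exact: mem0 | exact/nesym].
  split; first exact: memD.
  move=> /esym xyE; have [x0|y0] := airr _ _ Sx Sy xyE.
    by apply: ya; rewrite xyE x0 GRing.add0r.
  by apply: xa; rewrite xyE y0 GRing.addr0.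
move=> x Ax; split; last by move=> xa; apply: nAa; rewrite -xa.
by have <- : smallest (@submonoid d) A = S by []; move=> B [_]; apply.
Qed.

Lemma min_gensE : min_gens S = [set x | atom x]%classic.
Proof.
apply: xget_unique; first split; first exact: generates_atom.
  by move=> B sB gB; apply/seteqP; split=> //; exact: atom_sub_generators.
move=> A [gA minA]; apply/esym; apply: minA; last exact: generates_atom.
exact: atom_sub_generators.
Qed.

End Atoms.

(** * Cardinalities of sets of vectors *)

Section SetCard.
Variables (d : nat).
Local Notation Nd := 'rV[nat]_d.
Implicit Types (A : set Nd).

Lemma set_card1 (f : Nd) : set_card [set f]%classic = 1.
Proof. by rewrite /set_card fset_set1 finmap.cardfs1. Qed.

Lemma set_card_neq0 A : set_card A <> 0 -> finite_set A.
Proof.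
move=> A0; apply: contrapT => nfA; apply: A0; rewrite /set_card.
by rewrite /fset_set; case: pselect => // _; rewrite finmap.cardfs0.
Qed.

Lemma set_card1P A : set_card A = 1 -> exists f, A = [set f]%classic.
Proof.
move=> A1; have finA : finite_set A by apply: set_card_neq0; rewrite A1.
move/eqP: A1 => /finmap.cardfs1P[f Af]; exists f.
by rewrite -(fset_setK finA) Af set_fset1.
Qed.

Lemma uniq_leq_set_card A (s : seq Nd) : finite_set A ->
  uniq s -> {in s, forall x, A x} -> size s <= set_card A.
Proof.
move=> finA us sA; apply: uniq_leq_size => // x xs.
by rewrite in_fset_set //; apply/mem_set/sA.
Qed.

Lemma uniq_set_card_mem A (s : seq Nd) : finite_set A ->
  uniq s -> {in s, forall x, A x} -> set_card A <= size s ->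
  forall x, A x -> x \in s.
Proof.
move=> finA us sA cA x Ax.
have sub : {subset s <= fset_set A}.
  by move=> y ys; rewrite in_fset_set //; apply/mem_set/sA.
have [_ ->] := uniq_min_size us sub cA.
by rewrite in_fset_set //; apply/mem_set.
Qed.

End SetCard.

(** * Numerical semigroups *)

(** By Bezout every k is congruent to some x * a with x < b modulo b; such a k
    is a combination of a and b as soon as x * a <= k, so at a gap the multiple
    of a overshoots. *)
Lemma coprime_gap_repr a b k : 0 < a -> coprime a b ->
  ~ (exists u v, k = u * a + v * b) ->
  exists x y, [/\ x < b, 0 < y & x * a = k + y * b].
Proof.
move=> a0 cab ngk.
have [b0|b0] := posnP b.
  case: ngk; exists k, 0; move: cab; rewrite b0 /coprime gcdn0 => /eqP ->.
  by rewrite muln1 mul0n addn0.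
have [[u1 u2] /= u12] := coprimeP _ a0 cab.
have uE : u1 * a = u2 * b + 1 by lia.
have kE : k * u1 * a = k + k * u2 * b by nia.
have qE := divn_eq (k * u1) b.
set q := _ %/ _ in qE; set x := _ %% _ in qE.
have xE : x * a + q * a * b = k + k * u2 * b by rewrite -kE qE; lia.
have ltxb : x < b by rewrite ltn_mod.
have [le_q|lt_q] := leqP (k * u2) (q * a).
  by case: ngk; exists x, (q * a - k * u2); rewrite mulnBl; nia.
by exists x, (k * u2 - q * a); split=> //; rewrite ?subn_gt0 // mulnBl; nia.
Qed.

Section NumericalSemigroups.
Variable T : nat -> Prop.

(** The classical symmetry of numerical semigroups with two generators: F + b
    equals (b - 1) * a, so that reflecting the representation x * a = k + y * b
    of a gap k yields one of F - k with nonnegative coefficients. *)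
Lemma two_generated_symmetric a b F k : 0 < a -> coprime a b ->
  (forall n, T n <-> exists u v, n = u * a + v * b) ->
  ~ T F -> (forall n, F < n -> T n) -> ~ T k ->
  exists2 s, T s & k + s = F.
Proof.
move=> a0 cab TE nTF TgtF nTk.
have [|x0 [y0 [x0b y00 FE]]] := @coprime_gap_repr a b F a0 cab; first by rewrite -TE.
have [|x [y [xb ygt0 kE]]] := @coprime_gap_repr a b k a0 cab; first by rewrite -TE.
case: y0 y00 FE => // y0 _; rewrite mulSn => FE.
(* G is (b - 1) * a - b, in a form that shows F <= G. *)
pose G := F + y0 * b + (b - 1 - x0) * a.
have GE : G + b = (b - 1) * a.
  have -> : (b - 1) * a = x0 * a + (b - 1 - x0) * a by rewrite -mulnDl; congr (_ * _); lia.
  by rewrite FE /G; lia.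
have GF : G = F.
  have : F <= G by rewrite /G -addnA leq_addr.
  rewrite leq_eqVlt => /orP[/eqP//|/TgtF/TE[u [v uvE]]].
  (* b divides (b - 1 - u) * a, although 0 < b - 1 - u < b. *)
  have vE : (v + 1) * b = (b - 1 - u) * a by rewrite mulnBl -GE uvE; lia.
  have : b %| (b - 1 - u) * a by rewrite -vE dvdn_mull.
  rewrite Gauss_dvdl 1?coprime_sym // => /dvdn_leq; nia.
case: y ygt0 kE => // y _; rewrite mulSn => kE.
exists ((b - 1 - x) * a + y * b); first by apply/TE; exists (b - 1 - x), y.
suff : (b - 1) * a = x * a + (b - 1 - x) * a by rewrite -GF; lia.
by rewrite -mulnDl; congr (_ * _); lia.
Qed.

(** Adding multiples of a moves every s <= F of T to at most a - 1 below F, hence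
    to F - (a - 1) exactly, because F, F - 1, ..., F - (a - 2) are gaps. This
    determines s modulo a; since 0 is in T, the common residue is 0. *)
Lemma dvdn_of_final_run a F : T 0 -> (forall m n, T m -> T n -> T (m + n)) ->
  0 < a -> T a -> (forall t, t < a - 1 -> t <= F -> ~ T (F - t)) ->
  a %| F + 1 /\ forall s, T s -> s <= F -> a %| s.
Proof.
move=> T0 TD a0 Ta run.
have TM q : T (q * a) by elim: q => // q IHq; rewrite mulSn; apply: TD.
have aux s : T s -> s <= F -> a %| F + 1 - s.
  move=> Ts sF; have rE := divn_eq (F - s) a.
  have ra : (F - s) %% a < a by rewrite ltn_mod.
  set q := _ %/ _ in rE; set r := _ %% _ in rE ra.
  have [lt_r|ge_r] := ltnP r (a - 1).
    case: (run r lt_r); first by lia.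
    have -> : F - r = s + q * a by lia.
    exact: TD.
  have -> : F + 1 - s = q.+1 * a by rewrite mulSn; lia.
  exact: dvdn_mull.
have aF : a %| F + 1 by rewrite -[F + 1]subn0; apply: aux.
split=> // s Ts sF; have := aux s Ts sF.
by rewrite dvdn_subr //; lia.
Qed.

End NumericalSemigroups.

(** * Maximal gaps, axis atoms and mixed atoms *)

Section GNS.
Variables (d : nat) (S : set 'rV[nat]_d).
Local Notation Nd := 'rV[nat]_d.
Implicit Types (x y z f p : Nd) (i j : 'I_d).
Hypotheses (SM : submonoid S) (Sfin : finite_set (gaps S)).

Lemma gaps_bounded : exists N, forall x, N <= weight x -> S x.
Proof.
have /finite_seqP[s sE] := Sfin.
exists (\max_(x <- s) weight x).+1 => x ltx; apply: contrapT => gx.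
have : [set` s]%classic x by rewrite -sE.
move=> /= xs; move: ltx; rewrite ltnNge => /negP; apply.
exact: (@leq_bigmax_seq _ s xpredT (@weight d) x).
Qed.

(** A strictly increasing chain of gaps has increasing weights, which are
    bounded because the gaps are finitely many. *)
Lemma gap_le_maximal x : ~ S x ->
  exists2 f, frobenius_allowable S f & forall j, x ord0 j <= f ord0 j.
Proof.
have [N SN] := gaps_bounded.
have [n] := ubnP (N - weight x); elim: n x => // n IHn x lt_n gx.
have [xmax|] := pselect (frobenius_allowable S x); first by exists x.
move=> /not_andP[//|/existsNP[y /not_implyP[gy /not_implyP[/natural_leP le_xy neq_yx]]]].
have [z yE _] := leq_complement le_xy.
have z0 : z <> 0%R by move=> z0; apply: neq_yx; rewrite yE z0 GRing.addr0.
have ltNx : weight x < N by rewrite ltnNge; apply/negP => /SN.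
have [|f fmax le_yf] := IHn y _ gy.
  by rewrite yE weightD; have := weight_gt0 z0; lia.
by exists f => // j; apply: leq_trans (le_xy j) (le_yf j).
Qed.

(** Adding a nonzero element to a maximal gap leads strictly above it, hence
    out of the gaps. *)
Lemma FA_sub_PF : (frobenius_allowable S `<=` pseudo_frobenius S)%classic.
Proof.
move=> f [gf fmax]; split=> // s Ss s0; apply: contrapT => gfs.
have /(_ (ex_intro _ s erefl)) := fmax _ gfs => fsE; apply: s0.
apply/coordP => j; move/coordP/(_ j): fsE; rewrite coordD coord0; lia.
Qed.

Lemma PF_set1_FA f : pseudo_frobenius S = [set f]%classic ->
  frobenius_allowable S = [set f]%classic.
Proof.
move=> PFf; have [gf _] : pseudo_frobenius S f by rewrite PFf.
have FAf h : frobenius_allowable S h -> h = f.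
  by move=> /FA_sub_PF; rewrite PFf.
apply/seteqP; split=> [h /FAf //|_ ->].
by have [h fh _] := gap_le_maximal gf; rewrite -(FAf h).
Qed.

(** The atoms that sum up to a vector on an axis lie on that axis, so
    [atom_ind] restricts to the numerical semigroup that S cuts out there. *)
Lemma axis_ind i (P : nat -> Prop) : P 0 ->
  (forall a n, atom S (axis i a) -> S (axis i n) -> P n -> P (a + n)) ->
  forall n, S (axis i n) -> P n.
Proof.
move=> P0 PD n Sn.
suff /(_ n erefl) : forall k, axis i n = axis i k -> P k by [].
elim/(atom_ind SM): {n}(axis i n) / Sn => [k|a x aa Sx IHx k kE].
  by rewrite -(axis0 i) => /axis_inj <-.
have aE : a = axis i (a ord0 i).
  apply/coordP => j; rewrite axisE; case: eqP => [->//|/eqP ji].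
  by move/coordP/(_ j): kE; rewrite coordD axis_neq //; lia.
have xE : x = axis i (x ord0 i).
  apply/coordP => j; rewrite axisE; case: eqP => [->//|/eqP ji].
  by move/coordP/(_ j): kE; rewrite coordD axis_neq //; lia.
have -> : k = a ord0 i + x ord0 i by rewrite -coordD kE axisii.
by apply: PD; rewrite -?aE -?xE //; apply: IHx.
Qed.

Lemma axis_atom_gt0 i a : atom S (axis i a) -> 0 < a.
Proof. by case: posnP => // -> [_]; rewrite axis0. Qed.

Lemma axis_tail i : exists N, forall n, N <= n -> S (axis i n).
Proof.
have [N SN] := gaps_bounded; exists N => n le_n; apply: SN.
by apply: leq_trans le_n _; rewrite -{1}(axisii i n) coord_le_weight.
Qed.

Lemma axis_memM i a n : S (axis i a) -> S (axis i (n * a)).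
Proof.
move=> Sa; elim: n => [|n IHn]; first by rewrite mul0n axis0; apply: mem0.
by rewrite mulSn axisD; apply: memD.
Qed.

Lemma ex_axis_atom i : exists a, atom S (axis i a).
Proof.
apply: contrapT => na; have [N SN] := axis_tail i.
have : N.+1 = 0; last by [].
apply: (@axis_ind i (fun n => n = 0)) => //; last by apply: SN.
by move=> a n aa; case: na; exists a.
Qed.

(** With a single atom a the axis would carry multiples of a only, but it
    carries two consecutive numbers of S. *)
Lemma axis_atom_unique i a : atom S (axis i a) ->
  (forall b, atom S (axis i b) -> b = a) -> S (axis i 1).
Proof.
move=> aa ua; have [N SN] := axis_tail i.
have dv n : S (axis i n) -> a %| n.
  by apply: (@axis_ind i (fun n => a %| n)) => // b m /ua -> _; rewrite dvdn_addr.
have : a %| 1 by rewrite -(dvdn_addr 1 (dv N (SN _ (leqnn N)))) addn1; apply/dv/SN.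
by rewrite dvdn1 => /eqP a1; rewrite -a1; case: aa.
Qed.

Lemma ex_two_axis_atoms i : ~ S (axis i 1) -> exists a b,
  [/\ atom S (axis i a), atom S (axis i b) & a <> b].
Proof.
move=> gi; have [a aa] := ex_axis_atom i.
apply: contrapT => nex; apply: gi; apply: (axis_atom_unique aa) => b ab.
by apply: contrapT => /nesym ba; apply: nex; exists a, b.
Qed.

Lemma axis_two_generated i a b : atom S (axis i a) -> atom S (axis i b) ->
  (forall c, atom S (axis i c) -> c = a \/ c = b) ->
  coprime a b /\ forall n, S (axis i n) <-> exists u v, n = u * a + v * b.
Proof.
move=> aa ab ac.
have TE n : S (axis i n) <-> exists u v, n = u * a + v * b.
  split=> [|[u [v ->]]].
    apply: (@axis_ind i (fun n => exists u v, n = u * a + v * b)) n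
      => [|c m /ac ac' _ [u [v ->]]]; first by exists 0, 0.
    case: ac' => ->; [exists u.+1, v | exists u, v.+1]; rewrite mulSn; lia.
  by rewrite axisD; apply: memD => //; apply: axis_memM; [case: aa|case: ab].
split=> //; have [N SN] := axis_tail i.
have dv n : N <= n -> gcdn a b %| n.
  by move=> /SN/TE[u [v ->]]; rewrite dvdn_add // dvdn_mull ?dvdn_gcdl ?dvdn_gcdr.
by rewrite /coprime -dvdn1 -(dvdn_addr 1 (dv N (leqnn N))) addn1 dv.
Qed.

(** Take the least n such that e_i + n e_j is in S. In a decomposition one
    summand has i-th coordinate 1, hence the form e_i + n' e_j, because e_i + n e_j
    is supported on two axes; minimality of n leaves nothing for the other. *)
Lemma ex_mixed_atom i j : i != j -> ~ S (axis i 1) ->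
  exists2 n, 0 < n & atom S (axis i 1 + axis j n)%R.
Proof.
move=> ij gi; have [N SN] := gaps_bounded.
have exn : exists n, `[< S (axis i 1 + axis j n)%R >].
  exists N; apply/asboolP; apply: SN.
  by rewrite weightD (leq_trans _ (leq_addl _ _)) // -{1}(axisii j N) coord_le_weight.
have [n /asboolP Sn minn] := ex_minnP exn.
have n0 : 0 < n by case: posnP Sn => // ->; rewrite axis0 GRing.addr0.
exists n => //; split=> //.
  by move/coordP/(_ i); rewrite coordD axisii coord0.
have aux y z : S y -> (axis i 1 + axis j n)%R = (y + z)%R -> y ord0 i = 1 ->
    z = 0%R.
  move=> Sy yzE yi.
  have coE k : (k == i) + (if k == j then n else 0) = y ord0 k + z ord0 k.
    move/coordP/(_ k): yzE; rewrite !coordD !axisE => <-.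
    by case: (k == i).
  have yE : y = (axis i 1 + axis j (y ord0 j))%R.
    apply/coordP => k; rewrite coordD !axisE; have := coE k.
    case: eqP => [->|ki]; first by rewrite yi (negbTE ij).
    by case: eqP => [->|kj] //; lia.
  have := minn (y ord0 j); rewrite -yE => /(_ (introT (asboolP _) Sy)) le_n.
  apply/coordP => k; rewrite coord0; have := coE k.
  case: (k =P i) => [->|ki]; first by rewrite yi (negbTE ij); lia.
  by case: eqP => [->|kj] //=; lia.
move=> y z Sy Sz yzE.
have : y ord0 i + z ord0 i = 1.
  by rewrite -coordD -yzE coordD axisii axis_neq.
case yi: (y ord0 i) => [|[|k]] //; last by move=> _; right; apply: aux yzE yi.
by move=> zi; left; apply: (aux z y Sz _ zi); rewrite yzE GRing.addrC.
Qed.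

End GNS.

(** * Consequences of a unique maximal gap *)

Section UniqueMaximalGap.
Variables (d : nat) (S : set 'rV[nat]_d) (f : 'rV[nat]_d).
Local Notation Nd := 'rV[nat]_d.
Implicit Types (x y z p : Nd) (i j : 'I_d).
Hypotheses (SM : submonoid S) (Sfin : finite_set (gaps S)).
Hypothesis FAf : frobenius_allowable S = [set f]%classic.

Lemma gap_f : ~ S f.
Proof. by have [] : frobenius_allowable S f by rewrite FAf. Qed.

Lemma gap_le_f x : ~ S x -> forall j, x ord0 j <= f ord0 j.
Proof. by move=> /(gap_le_maximal Sfin)[h]; rewrite FAf => ->. Qed.

(** If e_i + e_j is the only atom with i-th coordinate 1, then every element of
    S with i-th coordinate 1 is obtained from e_i + e_j by adding an element of
    S. *)
Lemma gap_shift_diag i j g : i != j ->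
    (forall a, atom S a -> a ord0 i = 1 -> a = (axis i 1 + axis j 1)%R) ->
  ~ S (axis j g) -> ~ S (axis i 1 + axis j g.+1)%R.
Proof.
move=> ij ai gg Sx; apply: gg.
suff [] : S (axis i 1 + axis j g.+1)%R /\
    ((axis i 1 + axis j g.+1)%R ord0 i = 1 -> exists2 y, S y &
      (axis i 1 + axis j g.+1 = axis i 1 + axis j 1 + y)%R).
  move=> _ []; first by rewrite coordD axisii axis_neq.
  move=> y Sy xE; suff <- : y = axis j g by [].
  apply/coordP => k; move/coordP/(_ k): xE; rewrite !coordD !axisE.
  by case: (k == i); case: (k == j); lia.
elim/(atom_ind SM): {g}(axis i 1 + axis j g.+1)%R / Sx => [|a x aa Sx [_ IHx]].
  by split; [exact: mem0 | rewrite coord0].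
have [Sa _ _] := aa; split; first exact: memD.
rewrite coordD; case aI: (a ord0 i) => [|[|k]] //=.
  move=> /IHx[y Sy ->]; exists (a + y)%R; first exact: memD.
  by rewrite GRing.addrCA.
by move=> _; exists x; rewrite -?(ai a).
Qed.

(** If f_j e_j were a gap, the gap e_i + (f_j + 1) e_j would not be
    below f. So both f_i e_i and f_j e_j are in S, and so is their sum f. *)
Lemma two_missing_units_absurd i j : i != j -> (forall k, k = i \/ k = j) ->
  (forall a, atom S a -> a ord0 i = 1 -> a = (axis i 1 + axis j 1)%R) ->
  (forall a, atom S a -> a ord0 j = 1 -> a = (axis i 1 + axis j 1)%R) -> False.
Proof.
move=> ij dij ai aj; apply: gap_f.
have Sj : S (axis j (f ord0 j)).
  apply: contrapT => /(gap_shift_diag ij ai)/gap_le_f/(_ j).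
  by rewrite coordD axisii axis_neq 1?eq_sym // add0n ltnn.
have ji : j != i by rewrite eq_sym.
have Si : S (axis i (f ord0 i)).
  apply: contrapT => /(gap_shift_diag ji).
  move=> /(_ (fun a aa a1 => etrans (aj a aa a1) (GRing.addrC _ _))).
  by move=> /gap_le_f/(_ i); rewrite coordD axisii axis_neq // add0n ltnn.
have -> : f = (axis i (f ord0 i) + axis j (f ord0 j))%R; last exact: memD.
apply/coordP => k; rewrite coordD !axisE.
by case: (dij k) => ->; rewrite eqxx ?(negbTE ij) ?(negbTE ji) ?addn0.
Qed.

Section OneMissingUnit.
Variable i : 'I_d.
Hypothesis unit_mem : forall j, j != i -> S (axis j 1).

Lemma mem_coord0 x : x ord0 i = 0 -> S x.
Proof.
move=> xi; rewrite -(sum_axis x).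
apply: (big_ind S); [exact: mem0 | exact: memD | move=> j _].
have [->|ji] := eqVneq j i; first by rewrite xi axis0; apply: mem0.
by rewrite -[x ord0 j]muln1; apply: axis_memM => //; apply: unit_mem.
Qed.

(** Since S contains the e_j with j <> i, membership in S is monotone on each
    slice with constant i-th coordinate. *)
Lemma mem_up x y : S x -> x ord0 i = y ord0 i ->
  (forall j, x ord0 j <= y ord0 j) -> S y.
Proof.
move=> Sx xyi /leq_complement[z yE zE]; rewrite yE; apply: memD => //.
by apply: mem_coord0; rewrite zE xyi subnn.
Qed.

Lemma mem_axis x : S (axis i (x ord0 i)) -> S x.
Proof.
move=> Sx; apply: mem_up Sx _ _; first by rewrite axisii.
by move=> j; rewrite axisE; case: eqP => // ->.
Qed.

(** Together with [axis_mem_gt]: the i-th coordinate of f is the Frobenius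
    number of the numerical semigroup on the i-th axis. *)
Lemma axis_gap_f : ~ S (axis i (f ord0 i)).
Proof. by move=> /mem_axis; apply: gap_f. Qed.

Lemma axis_mem_gt n : f ord0 i < n -> S (axis i n).
Proof.
move=> ltfn; apply: contrapT => /gap_le_f/(_ i).
by rewrite axisii leqNgt ltfn.
Qed.

(** If s were nonzero, p + s would be in S; being below f in the slice of f, it
    would force f into S. The same reasoning with f - p in place of s then
    identifies p with f. *)
Lemma PF_eq_f_of_reach p s : pseudo_frobenius S p -> S s ->
  p ord0 i + s ord0 i = f ord0 i ->
  (forall j, p ord0 j + s ord0 j <= f ord0 j) -> p = f.
Proof.
move=> [gp PFp] Ss psi psf.
have gps : ~ S (p + s)%R.
  move=> Sps; apply: gap_f; apply: mem_up Sps _ _; first by rewrite coordD.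
  by move=> j; rewrite coordD.
have s0 : s = 0%R by apply: contrapT => s0; apply: gps; apply: PFp.
move: psi psf; rewrite s0 => psi psf.
have [j|z fE zE] := @leq_complement _ p f.
  by apply: leq_trans (psf j); apply: leq_addr.
have [z0|z0] := pselect (z = 0%R); first by rewrite fE z0 GRing.addr0.
case: gap_f; rewrite fE; apply: PFp => //; apply: mem_coord0.
by rewrite zE -psi coord0 addn0 subnn.
Qed.

Lemma PF_of_axis_complement p s : pseudo_frobenius S p -> S (axis i s) ->
  p ord0 i + s = f ord0 i -> p = f.
Proof.
move=> PFp Ss psf; have [gp _] := PFp.
apply: PF_eq_f_of_reach PFp Ss _ _; first by rewrite axisii.
move=> j; rewrite axisE; case: eqP => [->|_]; first by rewrite psf.
by rewrite addn0 gap_le_f.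
Qed.

(** The projection of p to the i-th axis is a gap there, and by symmetry of the
    numerical semigroup its distance to the Frobenius number f_i is in S. *)
Lemma PF_eq_f_two_axis_atoms a b p : atom S (axis i a) -> atom S (axis i b) ->
  (forall c, atom S (axis i c) -> c = a \/ c = b) ->
  pseudo_frobenius S p -> p = f.
Proof.
move=> aa ab ac PFp; have [gp _] := PFp.
have [cab TE] := axis_two_generated SM Sfin aa ab ac.
have [s Ss psE] := two_generated_symmetric (axis_atom_gt0 aa) cab TE
  axis_gap_f axis_mem_gt (fun Sp => gp (mem_axis Sp)).
exact: PF_of_axis_complement PFp Ss psE.
Qed.

(** Here the i-th axis may carry any number of atoms, but off this axis there are
    only the e_j and one e_i + n_j e_j for each j <> i. The level of x counts how
    many copies of the vectors n_j e_j fit below x. Each of them can be traded for a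
    step along the i-th axis, so that x is in S exactly when its i-th coordinate
    exceeds an element of the axis semigroup by at most the level of x; this is
    the content of [mem_of_level] and [level_of_mem]. *)
Section Levels.
Variables (n : 'I_d -> nat) (j0 : 'I_d).
Hypotheses (n_gt0 : forall j, 0 < n j) (j0i : j0 != i).
Hypothesis gap_unit : ~ S (axis i 1).
Hypothesis mixed_mem : forall j, j != i -> S (axis i 1 + axis j (n j))%R.
Hypothesis atomE : forall a, atom S a ->
  [\/ exists k, a = axis i k, exists2 j, j != i & a = axis j 1
    | exists2 j, j != i & a = (axis i 1 + axis j (n j))%R].

Definition level x : nat := \sum_(j | j != i) x ord0 j %/ n j.

Lemma leq_levelD x y : level x + level y <= level (x + y)%R.
Proof.
rewrite -big_split; apply: leq_sum => j _ /=.
by rewrite coordD divnD // leq_addr.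
Qed.

Lemma levelD_axis_i x k : level (axis i k + x)%R = level x.
Proof. by apply: eq_bigr => j ji; rewrite coordD axis_neq. Qed.

Lemma levelD_axis x j u : j != i -> level (axis j (u * n j) + x)%R = u + level x.
Proof.
move=> ji; rewrite /level (bigD1 j) //= (bigD1 (F := fun j => x ord0 j %/ n j) j) //=.
rewrite coordD axisii divnMDl // addnA; congr (_ + _).
by apply: eq_bigr => k /andP[_ kj]; rewrite coordD axis_neq.
Qed.

Lemma mem_of_level r x s : S (axis i s) -> x ord0 i = s + r -> r <= level x -> S x.
Proof.
move=> Ss; elim: r x => [|r IHr] x xi lt_r.
  by apply: mem_axis; rewrite xi addn0.
have [j /andP[ji nj]] : exists j, (j != i) && (n j <= x ord0 j).
  apply/existsP; apply: contraTT lt_r => /existsPn nle.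
  rewrite -leqNgt /level big1 // => j ji; apply: divn_small.
  by have := nle j; rewrite ji -ltnNge.
have [|y xE yE] := @leq_complement _ (axis i 1 + axis j (n j))%R x.
  move=> k; rewrite coordD !axisE; case: eqP => [->|_].
    by rewrite eq_sym (negbTE ji) xi; lia.
  by case: eqP => [->|_].
rewrite xE; apply: memD => //; first exact: mixed_mem.
apply: IHr; first by rewrite yE coordD axisii axis_neq 1?eq_sym // xi; lia.
by move: lt_r; rewrite xE -GRing.addrA levelD_axis_i -[n j]mul1n levelD_axis.
Qed.

Lemma level_of_mem x : S x -> exists s r,
  [/\ S (axis i s), x ord0 i = s + r & r <= level x].
Proof.
elim/(atom_ind SM): x / => [|a x aa Sx [s [r [Ss xi rx]]]].
  by exists 0, 0; split=> //; [rewrite axis0; exact: mem0 | rewrite coord0].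
have [Sa _ _] := aa; case: (atomE aa) => [[k aE]|[j ji aE]|[j ji aE]].
- exists (k + s), r; split; last by rewrite aE levelD_axis_i.
    by rewrite axisD; apply: memD; rewrite -?aE.
  by rewrite coordD aE axisii xi addnA.
- exists s, r; split=> //.
    by rewrite coordD aE axis_neq 1?eq_sym.
  by apply: leq_trans (leq_levelD _ _); apply: leq_trans rx (leq_addl _ _).
exists s, r.+1; split=> //.
  by rewrite coordD aE coordD axisii axis_neq 1?eq_sym // xi; lia.
by rewrite aE -GRing.addrA levelD_axis_i -[n j]mul1n levelD_axis.
Qed.

(** Let a be the multiplicity of the axis semigroup T and F = f_i. A gap with
    i-th coordinate a - 1 and level a - 2 shows that f is large in direction j0;
    as f is a gap, this makes F, F - 1, ..., F - (a - 2) gaps of T. By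
    [dvdn_of_final_run] the elements of T up to F are the multiples of a.
    Write p_i = q a + r with r < a. From p one reaches i-th coordinate F by adding
    multiples of a e_i and u = a - 1 - r copies of e_i + n_j0 e_j0. The sum is in S,
    so its level is at least a - 1, hence p has level at least r and is in S:
    a contradiction, unless nothing had to be added. *)
Lemma PF_eq_f_levels p : pseudo_frobenius S p -> p = f.
Proof.
move=> PFp; have [gp PFpD] := PFp.
have exa : exists a, (0 < a) && `[< S (axis i a) >].
  exists (f ord0 i).+1; apply/andP; split=> //; apply/asboolP.
  exact: axis_mem_gt.
have [a /andP[a_gt0 /asboolP Sa] mina] := ex_minnP exa.
have {}mina s : S (axis i s) -> s < a -> s = 0.
  move=> Ss lt_sa; case: (posnP s) => // s0.
  by move: lt_sa; rewrite ltnNge mina // s0; apply/asboolP.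
have a_gt1 : 1 < a.
  by rewrite ltn_neqAle a_gt0 andbT; apply/eqP => a1; apply: gap_unit; rewrite a1.
have n0 := n_gt0 j0.
(* The gap (a - 1) e_i + ((a - 1) n_j0 - 1) e_j0 lies below f. *)
have f_j0 : (a - 1) * n j0 - 1 <= f ord0 j0.
  have := @gap_le_f (axis i (a - 1) + axis j0 ((a - 1) * n j0 - 1))%R _ j0.
  rewrite coordD axisii axis_neq // add0n; apply=> /level_of_mem[s [r]].
  rewrite levelD_axis_i coordD axisii axis_neq 1?eq_sym // addn0.
  case=> Ss sr; have s0 : s = 0 by apply: mina => //; lia.
  rewrite leqNgt => /negP; apply.
  rewrite /level (bigD1 j0) //= big1 => [|j /andP[_ jj0]].
    by rewrite axisii addn0 ltn_divLR //; nia.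
  by rewrite axis_neq // div0n.
(* Otherwise t copies of e_i + n_j0 e_j0 would lift f_i - t to an element of S
   below f. *)
have run t : t < a - 1 -> t <= f ord0 i -> ~ S (axis i (f ord0 i - t)).
  move=> lt_t le_t St; apply: gap_f.
  have Sx : S (axis i (f ord0 i) + (axis j0 (t * n j0) + 0))%R.
    apply: (mem_of_level St (r := t)); last first.
      by rewrite levelD_axis_i levelD_axis // leq_addr.
    by rewrite !coordD axisii axis_neq 1?eq_sym // coord0; lia.
  apply: mem_up Sx _ _ => [|j]; rewrite !coordD coord0 addn0 !axisE.
    by rewrite eqxx eq_sym (negbTE j0i) addn0.
  case: eqP => [->|_]; first by rewrite eq_sym (negbTE j0i) addn0.
  by case: eqP => [->|//]; nia.
have [||dvdF dvdT] := @dvdn_of_final_run (fun s => S (axis i s)) a (f ord0 i) _ _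
    a_gt0 Sa run.
- by rewrite axis0; apply: mem0.
- by move=> k l; rewrite axisD; apply: memD.
have le_pf := gap_le_f gp.
have pE := divn_eq (p ord0 i) a; have ltr : p ord0 i %% a < a by rewrite ltn_mod.
set q := _ %/ _ in pE; set r := _ %% _ in pE ltr.
have /dvdnP[c cE] := dvdF.
have le_pF := le_pf i.
have qc : q < c by rewrite -(ltn_pmul2r a_gt0); lia.
pose m := c - 1 - q; pose u := a - 1 - r.
have mE : p ord0 i + (m * a + u) = f ord0 i.
  have : c * a = q * a + m * a + a by rewrite -mulnDl -mulSnr; congr (_ * _); lia.
  by rewrite /u; lia.
pose s := (axis i (m * a + u) + (axis j0 (u * n j0) + 0))%R.
have si : s ord0 i = m * a + u.
  by rewrite !coordD axisii axis_neq 1?eq_sym // coord0 !addn0.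
have Ss : S s.
  apply: (mem_of_level (axis_memM SM m Sa) si).
  by rewrite levelD_axis_i levelD_axis // leq_addr.
have [s0|s0] := pselect (s = 0%R).
  apply: PF_eq_f_of_reach PFp Ss _ _; first by rewrite si.
  by move=> j; rewrite s0 coord0 addn0.
case: gp; apply: (mem_of_level (axis_memM SM q Sa) pE).
have [s' [r' [Ss' psi]]] := level_of_mem (PFpD _ Ss s0).
rewrite /s GRing.addrC -GRing.addrA levelD_axis_i -GRing.addrA levelD_axis // GRing.add0r.
move: psi; rewrite coordD si mE => fE.
have : a %| r'.+1.
  rewrite -(@dvdn_addr s') ?(dvdT s') //; last by lia.
  by rewrite addnS -fE -addn1.
by move=> /dvdn_leq-/(_ isT); rewrite /u; lia.
Qed.

End Levels.
End OneMissingUnit.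
End UniqueMaximalGap.

(** * The shape of the atoms when there are 2d+1 of them *)

Section CountingAtoms.
Variables (d : nat) (S : set 'rV[nat]_d).
Local Notation Nd := 'rV[nat]_d.
Implicit Types (x y z f p : Nd) (i j l : 'I_d).

(** For each index l in L the vectors g l k are nonzero at l, while those of s and
    those of the other indices vanish there; so only k has to be recovered from
    g l k. *)
Lemma uniq_cat_allpairs (K : eqType) (s : seq Nd) (L : seq 'I_d) (ks : seq K)
    (g : 'I_d -> K -> Nd) :
  uniq s -> uniq L -> uniq ks ->
  {in s & L, forall x l, x ord0 l = 0} ->
  {in L, forall l k, g l k ord0 l <> 0} ->
  {in L &, forall l l', l' != l -> forall k, g l k ord0 l' = 0} ->
  {in L, forall l, injective (g l)} ->
  uniq (s ++ [seq g l k | l <- L, k <- ks]).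
Proof.
move=> us uL uks s0 gl gl' ginj; rewrite cat_uniq us /=; apply/andP; split.
  apply/hasPn => x /allpairsP[[l k] /= [lL _ ->]].
  by apply/negP => /s0/(_ lL); apply: gl.
apply: allpairs_uniq => // -[l k] [l' k'] /allpairsP[[l1 k1] /= [l1L _ [-> ->]]].
move=> /allpairsP[[l2 k2] /= [l2L _ [-> ->]]] gE.
have [l12|l12] := eqVneq l1 l2; last first.
  by case: (gl _ l1L k1); rewrite gE; apply: gl'.
by move: gE; rewrite -l12 => /ginj->.
Qed.

Hypotheses (SM : submonoid S) (Sfin : finite_set (gaps S)).
Hypothesis atoms_card : set_card [set x | atom S x]%classic = 2 * d + 1.

Let finA : finite_set [set x | atom S x]%classic.
Proof. by apply: set_card_neq0; rewrite atoms_card addn1. Qed.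

(** If S misses e_i and e_j, there are two atoms on each of these axes and one
    of the form e_i + m e_j, and for each further l three more: one on the l-th
    axis, one of the form e_i + n e_l and one of the form e_j + n' e_l. Hence
    5 + 3 (d - 2) <= 2 d + 1, so d = 2 and these five atoms are all. The atom
    e_j + m' e_i must then be e_i + m e_j, that is m = m' = 1. *)
Lemma atoms_two_missing_units i j : i != j ->
    ~ S (axis i 1) -> ~ S (axis j 1) ->
  [/\ forall k, k = i \/ k = j,
      forall a, atom S a -> a ord0 i = 1 -> a = (axis i 1 + axis j 1)%R
    & forall a, atom S a -> a ord0 j = 1 -> a = (axis i 1 + axis j 1)%R].
Proof.
move=> ij gi gj; have ji : j != i by rewrite eq_sym.
have [a1 [a2 [aa1 aa2 a12]]] := ex_two_axis_atoms SM Sfin gi.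
have [b1 [b2 [ab1 ab2 b12]]] := ex_two_axis_atoms SM Sfin gj.
have [m m0 am] := ex_mixed_atom Sfin ij gi.
have [m' m'0 am'] := ex_mixed_atom Sfin ji gj.
have [al alP] := choice (fun l => ex_axis_atom SM Sfin l).
have exn h : ~ S (axis h 1) ->
    exists n : 'I_d -> nat, forall l, h != l -> 0 < n l /\ atom S (axis h 1 + axis l (n l))%R.
  move=> gh.
  have [l|n nP] := @choice _ _ (fun (l : 'I_d) (k : nat) =>
    h != l -> 0 < k /\ atom S (axis h 1 + axis l k)%R); last by exists n.
  have [<-|hl] := eqVneq h l; first by exists 0.
  by have [k k0 ak] := ex_mixed_atom Sfin hl gh; exists k.
have [n nP] := exn i gi; have [n' n'P] := exn j gj.
pose L := enum (predC (pred2 i j)).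
have LP l : l \in L -> (l != i) && (l != j).
  by rewrite mem_enum !inE negb_or.
pose g l (k : option bool) := match k with
  | None => axis l (al l)
  | Some true => (axis i 1 + axis l (n l))%R
  | Some false => (axis j 1 + axis l (n' l))%R end.
pose s0 := [:: axis i a1; axis i a2; axis j b1; axis j b2; (axis i 1 + axis j m)%R].
pose s := s0 ++ [seq g l k | l <- L, k <- [:: None; Some true; Some false]].
have us : uniq s.
  apply: uniq_cat_allpairs; rewrite ?enum_uniq //; last 4 first.
  - move=> x l xs0 /LP/andP[li lj]; move: xs0; rewrite !inE.
    by do !case/orP; move/eqP->; rewrite ?coordD !axis_neq.
  - move=> l /LP/andP[li lj] [[]|] /=; rewrite ?coordD axisii.
    + by have [] := nP l; [rewrite eq_sym | lia].
    + by have [] := n'P l; [rewrite eq_sym | lia].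
    + by have := axis_atom_gt0 (alP l); lia.
  - move=> l l' _ /LP/andP[li lj] ll' [[]|] /=; by rewrite ?coordD !axis_neq.
  - move=> l /LP/andP[li lj] k k' /coordP gE; move: (gE i) (gE j).
    have il : i != l by rewrite eq_sym.
    have jl : j != l by rewrite eq_sym.
    by case: k k' {gE} => [[]|] [[]|] //=;
      rewrite ?coordD ?axisii ?(axis_neq _ il) ?(axis_neq _ jl)
        ?(axis_neq _ ij) ?(axis_neq _ ji).
  - have a10 := axis_atom_gt0 aa1; have a20 := axis_atom_gt0 aa2.
    have b10 := axis_atom_gt0 ab1; have b20 := axis_atom_gt0 ab2.
    rewrite /s0 /= !inE !negb_or -!andbA.
    have neqi x y : x ord0 i <> y ord0 i -> x != y.
      by move=> xy; apply/eqP => xyE; apply: xy; rewrite xyE.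
    have neqj x y : x ord0 j <> y ord0 j -> x != y.
      by move=> xy; apply/eqP => xyE; apply: xy; rewrite xyE.
    apply/and5P; split; last (apply/and5P; split; last (apply/andP; split=> //));
      try by [apply: neqi; rewrite ?coordD ?axisii ?(axis_neq _ ij); lia
             |apply: neqj; rewrite ?coordD ?axisii ?(axis_neq _ ji); lia].
    by apply/andP; split=> //;
       apply: neqi; rewrite ?coordD ?axisii ?(axis_neq _ ij); lia.
have As : {in s, forall x, atom S x}.
  move=> x; rewrite mem_cat => /orP[|/allpairsP[[l k] /= [/LP/andP[li lj] _ ->]]].
    by rewrite !inE; do !case/orP; move/eqP->.
  case: k => [[]|] /=; [apply: (nP l _).2|apply: (n'P l _).2|exact: alP];
    by rewrite eq_sym.
have sizeL : size L = d - 2.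
  by rewrite -cardE -[X in X - 2]card_ord -(cardC (pred2 i j)) card2 ij addKn.
have size_s : size s = 5 + 3 * (d - 2).
  by rewrite size_cat size_allpairs sizeL mulnC.
have le_s := uniq_leq_set_card finA us As.
move: le_s; rewrite atoms_card size_s => le_s.
have d_gt1 : 1 < d.
  have := max_card (pred2 i j); rewrite card2 ij card_ord; lia.
have L0 : L = [::] by apply: size0nil; lia.
have As0 a : atom S a -> a \in s0.
  move=> aa; have := uniq_set_card_mem finA us As _ aa.
  by rewrite atoms_card size_s /s L0 /= => -> //; lia.
have aiE a : atom S a -> a ord0 i = 1 -> a = (axis i 1 + axis j m)%R.
  move=> aa; have [Sa _ _] := aa; have := As0 a aa; rewrite !inE.
  by do !case/orP; move=> /eqP aE //; move: Sa;
    rewrite aE ?axisii ?(axis_neq _ ij) // => Sa e1; case: gi; rewrite -e1.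
have ajE a : atom S a -> a ord0 j = 1 -> a = (axis i 1 + axis j m)%R.
  move=> aa; have [Sa _ _] := aa; have := As0 a aa; rewrite !inE.
  by do !case/orP; move=> /eqP aE //; move: Sa;
    rewrite aE ?axisii ?(axis_neq _ ji) // => Sa e1; case: gj; rewrite -e1.
have m1 : m = 1.
  have := ajE _ am'; rewrite coordD axisii (axis_neq _ ji) => /(_ erefl)/coordP/(_ j).
  by rewrite !coordD !axisii !(axis_neq _ ji).
move: aiE ajE; rewrite m1 => aiE ajE; split=> // k.
have : k \notin L by rewrite L0.
by rewrite mem_enum !inE negbK => /orP[] /eqP; [left | right].
Qed.

(** Three atoms on the i-th axis and, for each other j, the atom e_j and one of
    the form e_i + n_j e_j make 3 + 2 (d - 1) = 2 d + 1 atoms already. *)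
Lemma atoms_one_missing_unit i a b c : ~ S (axis i 1) ->
    (forall j, j != i -> S (axis j 1)) ->
    atom S (axis i a) -> atom S (axis i b) -> atom S (axis i c) ->
    a <> b -> a <> c -> b <> c ->
  exists n : 'I_d -> nat,
    [/\ forall j, 0 < n j, forall j, j != i -> S (axis i 1 + axis j (n j))%R
      & forall x, atom S x -> [\/ exists k, x = axis i k,
          exists2 j, j != i & x = axis j 1
        | exists2 j, j != i & x = (axis i 1 + axis j (n j))%R]].
Proof.
move=> gi unit_mem aa ab ac ab' ac' bc'.
have [l|n nP] := @choice _ _ (fun (l : 'I_d) (k : nat) =>
    0 < k /\ (i != l -> atom S (axis i 1 + axis l k)%R)).
  (* A positive default value at i itself. *)
  have [<-|il] := eqVneq i l; first by exists 1.
  by have [k k0 ak] := ex_mixed_atom Sfin il gi; exists k.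
have unit_atom j : j != i -> atom S (axis j 1).
  move=> ji; split; first exact: unit_mem.
    by move/coordP/(_ j); rewrite axisii coord0.
  move=> y z _ _ /(congr1 (@weight d)); rewrite weightD.
  have -> : weight (axis j 1) = 1.
    by rewrite /weight (bigD1 j) //= axisii big1 // => k; apply: axis_neq.
  case yw: (weight y) => [|k] w1; first by left; apply: weight_eq0.
  by right; apply: weight_eq0; lia.
pose L := enum (predC1 i).
have LP l : l \in L -> l != i by rewrite mem_enum !inE.
pose g l (k : bool) := if k then axis l 1 else (axis i 1 + axis l (n l))%R.
pose s0 := [:: axis i a; axis i b; axis i c].
pose s := s0 ++ [seq g l k | l <- L, k <- [:: true; false]].
have us : uniq s.
  apply: uniq_cat_allpairs; rewrite ?enum_uniq //; last 4 first.
  - move=> x l xs0 /LP li; move: xs0; rewrite !inE.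
    by do !case/orP; move/eqP->; rewrite axis_neq.
  - move=> l /LP li [] /=; rewrite ?coordD axisii //.
    by have [] := nP l; lia.
  - by move=> l l' _ /LP li ll' [] /=; rewrite ?coordD !axis_neq.
  - move=> l /LP li k k' /coordP/(_ i); have il : i != l by rewrite eq_sym.
    by case: k k' => [] [] //=; rewrite ?coordD ?axisii ?(axis_neq _ il).
  by rewrite /s0 /= !inE !negb_or !andbT; apply/andP; split;
    [apply/andP; split|]; apply/eqP => /axis_inj.
have As : {in s, forall x, atom S x}.
  move=> x; rewrite mem_cat => /orP[|/allpairsP[[l k] /= [/LP li _ ->]]].
    by rewrite !inE; do !case/orP; move/eqP->.
  by case: k => /=; [exact: unit_atom | apply: (nP l).2; rewrite eq_sym].
have size_s : size s = 2 * d + 1.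
  have d0 : 0 < d := leq_ltn_trans (leq0n i) (ltn_ord i).
  rewrite size_cat size_allpairs /= -cardE cardC1 card_ord; lia.
exists n; split=> [j|j ji|x ax]; first by case: (nP j).
  by case: ((nP j).2 _); rewrite 1?eq_sym.
have := uniq_set_card_mem finA us As _ ax; rewrite size_s atoms_card leqnn => /(_ isT).
rewrite mem_cat => /orP[|/allpairsP[[l [|]] /= [/LP li _ ->]]].
- by rewrite !inE => /or3P[] /eqP->; constructor 1; [exists a | exists b | exists c].
- by constructor 2; exists l.
- by constructor 3; exists l.
Qed.

End CountingAtoms.

(** * Symmetry and almost symmetry *)

Lemma PF_eq_f d (S : set 'rV[nat]_d) (f p : 'rV[nat]_d) : 1 < d ->
    submonoid S -> finite_set (gaps S) ->
    set_card [set x | atom S x]%classic = 2 * d + 1 ->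
    frobenius_allowable S = [set f]%classic -> pseudo_frobenius S p -> p = f.
Proof.
move=> d_gt1 SM Sfin Scard FAf PFp.
have [i gi] : exists i, ~ S (axis i 1).
  apply: contrapT => /forallNP unit_mem; apply: (gap_f FAf).
  rewrite -(sum_axis f); apply: (big_ind S); [exact: mem0 | exact: memD |].
  move=> j _; rewrite -[f ord0 j]muln1; apply: axis_memM => //.
  by apply: contrapT; apply: unit_mem.
have unit_mem j : j != i -> S (axis j 1).
  move=> ji; apply: contrapT => gj; have ij : i != j by rewrite eq_sym.
  have [dij ai aj] := atoms_two_missing_units SM Sfin Scard ij gi gj.
  by case: (two_missing_units_absurd SM Sfin FAf ij dij ai aj).
have [a [b [aa ab a_b]]] := ex_two_axis_atoms SM Sfin gi.
have [abE|] := pselect (forall c, atom S (axis i c) -> c = a \/ c = b).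
  exact (PF_eq_f_two_axis_atoms SM Sfin FAf unit_mem aa ab abE PFp).
move=> /existsNP[c /not_implyP[ac /not_orP[c_a c_b]]].
have [n [n_gt0 mixed atomE]] := atoms_one_missing_unit Sfin Scard gi unit_mem
  aa ab ac a_b (nesym c_a) (nesym c_b).
have [j0 j0i] : exists j0, j0 != i.
  have [i0|i0] := eqVneq (val i) 0; last first.
    by exists (Ordinal (ltnW d_gt1)); rewrite -val_eqE /= eq_sym.
  by exists (Ordinal d_gt1); rewrite -val_eqE /= i0.
exact (PF_eq_f_levels SM Sfin FAf unit_mem n_gt0 j0i gi mixed atomE PFp).
Qed.

Theorem theorem3p1 (d : nat) (S : set 'rV[nat]_d) (d_gt1 : (1 < d)%N)
    (S_gns : gen_num_semigroup S) (S_edim : embedding_dim S = (2 * d + 1)%N) :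
  (symmetric_semigroup S <-> set_card (frobenius_allowable S) = 1%N) /\
  (almost_symmetric S <-> symmetric_semigroup S).
Proof.
have [SM Sfin] := S_gns.
move: S_edim; rewrite /embedding_dim min_gensE // => Scard.
have PF_of_FA f : frobenius_allowable S = [set f]%classic ->
    pseudo_frobenius S = [set f]%classic.
  move=> FAf; apply/seteqP; split=> [p PFp|_ ->].
    exact: PF_eq_f d_gt1 SM Sfin Scard FAf PFp.
  by apply: FA_sub_PF; rewrite FAf.
have symP : symmetric_semigroup S <->
    exists f, frobenius_allowable S = [set f]%classic.
  split=> [/set_card1P[f PFf]|[f /PF_of_FA PFf]].
    by exists f; apply: PF_set1_FA.
  by rewrite /symmetric_semigroup /semigroup_type PFf set_card1.
split; split.
- by move=> /symP[f ->]; rewrite set_card1.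
- by move=> /set_card1P FA1; apply/symP.
- by move=> [f FAf _]; apply/symP; exists f.
move=> /symP[f FAf]; exists f => // p.
by rewrite (PF_of_FA f FAf) => /= ->.
Qed.
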